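(* Let $N\ge 1$, let $\lambda_i>0$, $c_i>0$, $m_i\ge 0$ for $i=1,\dots,N$, let $T_{\max}>0$, and let $$\mathcal C(T)=\sum_{i=1}^N \Big(c_i+(\lambda_i m_i-c_i)e^{-\lambda_i T}\Big).$$ For each $i$ and $n$, let $\hat\lambda_i=\hat\lambda_i(n)$ be an unbiased estimate of $\lambda_i$, i.e. a random variable with $\mathbb E[\hat\lambda_i(n)]=\lambda_i$. Let $\{X(n,T(n))\}_{n}$ be a sequence of independent random variables (conditionally on the current value $T(n)$) such that $X(n,T(n))$ is equal to $\hat\lambda_i m_i-c_i$ with probability $$\frac{\lambda_i e^{-\lambda_i T(n)}}{\sum_{j=1}^N\lambda_j e^{-\lambda_j T(n)}},\qquad i=1,\dots,N.$$ Let $\{\epsilon(n)\}_{n\in\mathbb N}$ be a non-negative sequence converging to $0$ such that $\sum_{n\in\mathbb N}\epsilon(n)=\infty$ and $\sum_{n\in\mathbb N}\epsilon^2(n)<\infty$. Consider the update rule $$T(n+1)=\Pi_{[0,T_{\max}]}\big(T(n)+\epsilon(n)X(n,T(n))\big),$$ where $\Pi_{[0,T_{\max}]}(x)=\min(\max(0,x),T_{\max})$. Then, with probability one, the sequence $T(n)$ converges either (i) to a stationary point of $\mathcal C$, or (ii) to $0$ or to $T_{\max}$, if that endpoint is a local minimum of $\mathcal C$ (over $[0,T_{\max}]$).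
   Context: Setting: a cache with a finite catalogue of $N$ contents; requests for content $i$ arrive as independent Poisson processes of rate $\lambda_i$. $c_i$ is the storage cost per unit of time of content $i$ (size of the content times cost per unit of size and time), $m_i$ is the cost of a miss for content $i$. $\mathcal C(T)$ is the asymptotic time-average cost (storage plus misses) of a TTL cache with renewal and constant timer $T$. A stationary point of $\mathcal C$ is a point where $d\mathcal C/dT=0$. The meaning of the random correction $X(n,T(n))$ is: given the current value $T(n)\in[0,T_{\max}]$, and independently of the past, an index $i\in\{1,\dots,N\}$ is drawn with probability $\lambda_i e^{-\lambda_i T(n)}/\sum_{j}\lambda_j e^{-\lambda_j T(n)}$, and then $X(n,T(n))=\hat\lambda_i m_i-c_i$, where the estimate satisfies $\mathbb E(\hat\lambda_i m_i-c_i)=\lambda_i m_i-c_i$.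
   Formalization: The variances of the unbiased estimates are additionally assumed bounded uniformly in i and n; with unbiasedness alone the claim is false (heavy-tailed estimates can drive T(n) to 0 although the cost is strictly decreasing). *)

(* Defs.v *)
From HB Require Import structures.
From mathcomp Require Import all_boot all_order all_algebra.
From mathcomp Require Import all_classical all_reals all_analysis.

Set Implicit Arguments.
Unset Strict Implicit.
Unset Printing Implicit Defensive.

Import Order.TTheory GRing.Theory Num.Theory.
Import numFieldNormedType.Exports.

Local Open Scope classical_set_scope.
Local Open Scope ring_scope.

Section cost.
Context {R : realType} {N : nat}.
Implicit Types (lam c m : 'I_N -> R).

Definition ttl_cost lam c m (T : R) : R :=
  \sum_(i < N) (c i + (lam i * m i - c i) * expR (- (lam i * T))).

Definition draw_prob lam (T : R) (i : 'I_N) : R :=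
  lam i * expR (- (lam i * T)) / \sum_(j < N) lam j * expR (- (lam j * T)).

Definition proj_itv (Tmax x : R) : R := Num.min (Num.max 0 x) Tmax.

Definition stationary_point (f : R -> R) (x : R) : Prop :=
  is_derive x (1 : R) f 0.

Definition local_min_on (D : set R) (f : R -> R) (x : R) : Prop :=
  D x /\ \forall y \near within D (nbhs x), f x <= f y.

End cost.

Section process.
Context {R : realType} {N : nat} {d : measure_display} {Omega : measurableType d}.
Variable P : probability Omega R.
Implicit Types (lam c m : 'I_N -> R) (lamhat : 'I_N -> nat -> {RV P >-> R}).
Implicit Types (J : nat -> Omega -> 'I_N) (T : nat -> {RV P >-> R}).

(* [J n] is the content drawn at step [n]. *)
Definition correction c m lamhat J (n : nat) (w : Omega) : R :=
  lamhat (J n w) n w * m (J n w) - c (J n w).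

(* The sigma-algebra generated by T(0), ..., T(n) and X(0), ..., X(n-1). *)
Definition history c m lamhat J T (n : nat) : set (set Omega) :=
  <<s [set A | exists2 B : set R, measurable B &
        (exists2 k, (k <= n)%N & A = T k @^-1` B) \/
        (exists2 k, (k < n)%N & A = correction c m lamhat J k @^-1` B)] >>.

(* Given the history up to T(n), the drawn content has law [draw_prob lam T(n)]:
   P(J(n) = i | history) = draw_prob lam T(n) i, with the conditional
   probability characterised by its integrals over the events of the history. *)
Definition draw_law lam c m lamhat J T : Prop :=
  forall (n : nat) (i : 'I_N),
    measurable (J n @^-1` [set i]) /\
    forall A, history c m lamhat J T n A ->
      P (A `&` J n @^-1` [set i]) =
      (\int[P]_(w in A) (draw_prob lam (T n w) i)%:E)%E.

(* When content i is drawn, its estimate is independent of the history and of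
   the draw.  No independence is required between the estimates of different
   contents at the same step. *)
Definition estimate_indep c m lamhat J T : Prop :=
  forall (n : nat) (i : 'I_N) (A : set Omega) (B : set R),
    history c m lamhat J T n A -> measurable B ->
    P ((A `&` J n @^-1` [set i]) `&` lamhat i n @^-1` B) =
    (P (A `&` J n @^-1` [set i]) * P (lamhat i n @^-1` B))%E.

Definition unbiased lam lamhat : Prop :=
  forall i n, ('E_P[lamhat i n] = (lam i)%:E)%E.

(* Unbiasedness alone does not suffice for the convergence of the projected
   iteration: with N = 1, lam = 1, m = 2, c = 1, eps(n) = 1 / (n + 1) and
   independent estimates equal to (n + 1)^2 with probability 1 / (n + 1)^2 and
   to 0 otherwise, T(n) tends to 0 almost surely although the cost is strictly
   decreasing.  Hence the usual Robbins-Monro moment condition. *)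
Definition bounded_variance lamhat : Prop :=
  exists M : R, forall i n, ('V_P[lamhat i n] <= M%:E)%E.

End process.

(* Main.v *)
Require Import Defs.
From HB Require Import structures.
From mathcomp Require Import all_boot all_order all_algebra.
From mathcomp Require Import all_classical all_reals all_analysis.
From mathcomp Require Import measurable_realfun.
From mathcomp Require Import ring lra.

Import Order.TTheory GRing.Theory Num.Theory.
Import numFieldNormedType.Exports.

Local Open Scope classical_set_scope.
Local Open Scope ring_scope.

(* Write the correction as drift plus noise, where drift = - C' / S with
   S(T) = sum_j lam_j exp (- lam_j T) > 0, and the noise is a martingale
   difference with uniformly bounded second moment.  By Kolmogorov's maximal
   inequality the series of eps(n) * noise(n) converges almost surely.  On that
   event the argument is pathwise: an interval on which the drift is <= 0
   (resp. >= 0) is eventually never crossed upwards (resp. downwards), so T(n)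
   converges; and since the eps(n) sum to infinity, the drift cannot be positive
   at a limit < Tmax, nor negative at a limit > 0. *)

(** * Martingale differences *)

(** The draw picks content [i] with weight [lam i * expR (- (lam i * T))], which up to sign is also
    the weight of [lam i * m i - c i] in C'. The iteration is thus a stochastic gradient descent
    whose gradient carries a positive, state-dependent factor. The cost need not be convex and its
    derivative may vanish at several points, so there is no single target towards which a distance
    could be shown to decrease; counting crossings of small intervals replaces such a Lyapunov
    argument. There, eps(n) tending to 0 prevents the drift from jumping across an interval in one
    step. No conditional expectation is constructed. Being centred given the past means having zero
    integral over every event of the generated sigma-algebra, and this is used in one way only: a
    factor measurable for the past can be inserted under the integral as long as the product stays
    integrable. *)

Section orthogonality.
Import HBNNSimple.
Context {R : realType} {d : measure_display} {Omega : measurableType d}.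
Variables (mu : {measure set Omega -> \bar R}) (G : set (set Omega)).
Hypothesis subG : <<s G >> `<=` measurable.

Lemma measurable_fun_subalgebra (Z : Omega -> R) :
  measurable_fun [set: g_sigma_algebraType G] Z -> measurable_fun setT Z.
Proof. by move=> mZ _ B mB; apply: subG; exact: (mZ measurableT B mB). Qed.

Variable xi : Omega -> R.
Hypothesis ixi : mu.-integrable setT (EFin \o xi).
Hypothesis xi0 : forall A, <<s G >> A -> (\int[mu]_(w in A) (xi w)%:E = 0)%E.

Let integral_mul_simple (g : {nnsfun g_sigma_algebraType G >-> R}) :
  (\int[mu]_w (g w * xi w)%:E = 0)%E.
Proof.
have mg y : <<s G >> (g @^-1` [set y]).
  by have := @measurable_funPTI _ _ _ _ g [set y] (measurable_set1 y).
have gE y : (fun w => (y * \1_(g @^-1` [set y]) w * xi w)%:E) =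
    (fun w => y%:E * ((EFin \o xi) \_ (g @^-1` [set y])) w)%E.
  apply/funext => w; rewrite patchE indicE.
  by case: ifPn => _ /=; rewrite ?mulr1 ?mulr0 ?mul0r ?mule0 ?EFinM.
have ig y : mu.-integrable setT ((EFin \o xi) \_ (g @^-1` [set y])).
  apply/(integrable_mkcond _ _).1; first exact: subG.
  by apply: integrableS ixi => //; exact: subG.
under eq_integral => w _ do rewrite (fimfunEord g) mulr_suml -sumEFin.
rewrite integral_sum//= => [|i]; last by rewrite gE; exact: integrableZl.
rewrite big1// => i _.
by rewrite gE integralZl// -integral_mkcond (xi0 _ (mg _)) mule0.
Qed.

Let integral_mul_ge0 (Z : Omega -> R) :
  measurable_fun [set: g_sigma_algebraType G] Z -> (forall w, 0 <= Z w) ->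
  mu.-integrable setT (fun w => (Z w * xi w)%:E) ->
  (\int[mu]_w (Z w * xi w)%:E = 0)%E.
Proof.
move=> mZ Z0 iZ.
have mZ' := (measurable_EFinP _ _).2 mZ.
(* The approximation is taken over the sub-sigma-algebra, so the level sets of each [g n] are events
   on which [xi] integrates to zero. Since [g n <= Z], the products are dominated by [|Z * xi|]. *)
pose g := nnsfun_approx measurableT mZ'.
have mxi : measurable_fun setT xi by exact/measurable_EFinP/(measurable_int _ ixi).
have cvg_g w : EFin \o g^~ w @ \oo --> (Z w)%:E.
  by apply: cvg_nnsfun_approx => // x _; rewrite lee_fin.
have gZ n w : g n w <= Z w.
  have gZ : g^~ w @ \oo --> Z w by exact: (fine_cvg (cvg_g w)).
  rewrite -(cvg_lim _ gZ)//; apply: (nondecreasing_cvgn_le (u_ := g^~ w)).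
    by move=> p q pq; have /lefP := nd_nnsfun_approx measurableT mZ' pq.
  by apply/cvg_ex; exists (Z w).
have [] := @dominated_convergence _ _ _ mu setT measurableT
  (fun n w => (g n w * xi w)%:E) (fun w => (Z w * xi w)%:E)
  (fun w => `|(Z w * xi w)%:E|%E).
- move=> n; apply/measurable_EFinP/measurable_funM => //.
  exact: measurable_fun_subalgebra.
- exact: measurable_int iZ.
- apply: aeW => w _; under eq_fun do rewrite EFinM.
  by rewrite EFinM; apply: cvgeMr => //; exact: cvg_g.
- exact: integrable_abse iZ.
- apply: aeW => w n _ /=; rewrite lee_fin !normrM ler_wpM2r//.
  by rewrite !ger0_norm.
move=> _ _; under eq_fun do rewrite integral_mul_simple.
by move=> /(cvg_lim (@ereal_hausdorff R)) <-; rewrite lim_cst.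
Qed.

(** The positive and negative parts of [Z] remain measurable for the sub-sigma-algebra, and their
    products with [xi] are dominated by [|Z * xi|]; neither boundedness nor square integrability of
    [Z] enters. *)
Lemma integral_mul_orthogonal (Z : Omega -> R) :
  measurable_fun [set: g_sigma_algebraType G] Z ->
  mu.-integrable setT (fun w => (Z w * xi w)%:E) ->
  (\int[mu]_w (Z w * xi w)%:E = 0)%E.
Proof.
move=> mZ iZ.
have mxi : measurable_fun setT xi by exact/measurable_EFinP/(measurable_int _ ixi).
pose Zp w := Num.max (Z w) 0; pose Zn w := Num.max (- Z w) 0.
have mZp : measurable_fun [set: g_sigma_algebraType G] Zp.
  by apply: measurable_maxr => //; exact: measurable_cst.
have mZn : measurable_fun [set: g_sigma_algebraType G] Zn.
  by apply: measurable_maxr; [exact: measurableT_comp|exact: measurable_cst].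
have Zp0 w : 0 <= Zp w by rewrite le_max lexx orbT.
have Zn0 w : 0 <= Zn w by rewrite le_max lexx orbT.
have iZp : mu.-integrable setT (fun w => (Zp w * xi w)%:E).
  apply: le_integrable iZ => //.
    by apply/measurable_EFinP/measurable_funM => //; exact: measurable_fun_subalgebra.
  move=> w _; rewrite lee_fin !normrM ler_wpM2r// (ger0_norm (Zp0 w)) ge_max.
  by rewrite ler_norm normr_ge0.
have iZn : mu.-integrable setT (fun w => (Zn w * xi w)%:E).
  apply: le_integrable iZ => //.
    by apply/measurable_EFinP/measurable_funM => //; exact: measurable_fun_subalgebra.
  move=> w _; rewrite lee_fin !normrM ler_wpM2r// (ger0_norm (Zn0 w)) ge_max.
  by rewrite -normrN ler_norm normr_ge0.
under eq_integral => w _.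
  have -> : Z w * xi w = Zp w * xi w - Zn w * xi w.
    rewrite -mulrBl; congr (_ * _); rewrite /Zp /Zn.
    by case: (leP (Z w) 0); case: (leP (- Z w) 0) => ??; lra.
  rewrite EFinB; over.
by rewrite integralB// !integral_mul_ge0// sube0.
Qed.

End orthogonality.

(** Orthogonality with the roles exchanged: the sub-sigma-algebra is the one generated by [X], and
    independence says that [\1_D - P D] has zero integral over each of its events. The factor
    inserted is [X] itself. *)
Lemma integral_indep {R : realType} {d : measure_display}
    {Omega : measurableType d} (P : probability Omega R) (D : set Omega)
    (X : Omega -> R) :
  measurable D -> P.-integrable setT (EFin \o X) ->
  (forall B, measurable B -> P (D `&` X @^-1` B) = P D * P (X @^-1` B))%E ->
  (\int[P]_(w in D) (X w)%:E = P D * \int[P]_w (X w)%:E)%E.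
Proof.
move=> mD iX indep.
pose G := preimage_set_system setT X measurable.
have sG : <<s G >> `<=` G.
  by rewrite /G sigma_algebra_id//; apply: sigma_algebra_preimage; exact: sigma_algebra_measurable.
have mX : measurable_fun setT X by exact/measurable_EFinP/(measurable_int _ iX).
have subG : <<s G >> `<=` measurable.
  by move=> A /sG [B mB <-]; exact: mX.
pose p := fine (P D).
have pE : (P D = p%:E)%E by rewrite fineK// fin_num_measure.
pose xi w : R := \1_D w - p.
have i1 : P.-integrable setT (EFin \o \1_D) by exact: integrable_indic.
have ip (A : set Omega) : measurable A -> P.-integrable A (EFin \o cst p).
  by move=> mA; exact: finite_measure_integrable_cst.
have ixi : P.-integrable setT (EFin \o xi).
  rewrite (_ : EFin \o xi = (EFin \o \1_D) \- (EFin \o cst p))%E//.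
  by apply: integrableB => //; exact: ip.
have xi0 A : <<s G >> A -> (\int[P]_(w in A) (xi w)%:E = 0)%E.
  move=> GA; have mA := subG _ GA.
  under eq_integral do rewrite EFinB.
  rewrite integralB//; [|exact: integrableS i1|exact: ip].
  rewrite integral_indic// integral_cst//.
  have [B mB] := sG _ GA; rewrite setTI => XBA.
  rewrite -XBA [X in (X - _)%E](indep B mB) XBA pE subee//.
  by rewrite fin_numM// fin_num_measure.
have iX1 : P.-integrable setT (EFin \o X \_ D).
  rewrite -restrict_EFin; apply/(integrable_mkcond _ _).1 => //.
  exact: integrableS iX.
have ipX : P.-integrable setT (fun w => p%:E * (EFin \o X) w)%E by exact: integrableZl.
have XxiE w : (X w * xi w)%:E = ((EFin \o X \_ D) w - p%:E * (EFin \o X) w)%E.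
  rewrite -EFinM -EFinB /= patchE /xi indicE.
  (* Outside [D] the restriction takes the default value [point], which is [0] in [R] by
     conversion. *)
  case: ifPn => _ /=; congr (_%:E); last change (point : R) with (0 : R); ring.
have iXxi : P.-integrable setT (fun w => (X w * xi w)%:E).
  by under eq_fun do rewrite XxiE; exact: integrableB.
have XG : measurable_fun [set: g_sigma_algebraType G] X.
  exact: preimage_set_system_measurable_fun.
have := integral_mul_orthogonal P G subG xi ixi xi0 X XG iXxi.
under eq_integral do rewrite XxiE.
rewrite integralB// -restrict_EFin -integral_mkcond integralZl// pE.
move=> /eqP; rewrite sube_eq ?add0e => [/eqP//||];
  rewrite ?fin_num_adde_defl ?integrable_fin_num//.
- exact: integrableS iX.
- by rewrite fin_numM// integrable_fin_num.
Qed.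

Section stopped_sum.
Context {R : realType}.
Implicit Types (u : nat -> R) (dl : R).

(* The sum freezes once its modulus reaches [dl].  While it moves, its square
   grows by [2 * s * u k + u k ^+ 2] with [`|s| < dl], so the cross term is
   integrable whatever the overshoots of earlier steps. *)
Fixpoint stopped_sum dl u n : R :=
  if n is k.+1 then
    let s := stopped_sum dl u k in if `|s| < dl then s + u k else s
  else 0.

Lemma le_norm_stopped_sumS dl u n :
  dl <= `|stopped_sum dl u n| -> dl <= `|stopped_sum dl u n.+1|.
Proof. by move=> /[dup] h; rewrite leNgt /= => /negbTE ->. Qed.

Lemma stopped_sumP dl u n :
  stopped_sum dl u n = series u n \/ dl <= `|stopped_sum dl u n|.
Proof.
elim: n => [|n [ih|/le_norm_stopped_sumS]]; [|rewrite /=|by right].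
  by left; rewrite seriesEnat /= big_geq.
by case: ltP => [_|]; [left; rewrite ih seriesSr|right].
Qed.

(** Reaching [dl] is irreversible for the stopped sum but not for the series. This inclusion
    replaces the maximal event by an increasing union, whose measure is a limit. *)
Lemma le_norm_stopped_sum dl u n :
  dl <= `|series u n| -> dl <= `|stopped_sum dl u n|.
Proof. by case: (stopped_sumP dl u n) => // ->. Qed.

End stopped_sum.

Lemma integrable_sqr {R : realType} {d : measure_display}
  {Omega : measurableType d} (mu : {finite_measure set Omega -> \bar R})
  (f : Omega -> R) : measurable_fun setT f ->
  (\int[mu]_w (f w ^+ 2)%:E < +oo)%E -> mu.-integrable setT (EFin \o f).
Proof.
move=> mf f2; apply: (@le_integrable _ _ _ mu setT _ _
  (fun w => (1 + f w ^+ 2)%:E)) => //.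
- exact/measurable_EFinP.
- move=> w _ /=; rewrite lee_fin [leRHS]ger0_norm ?addr_ge0 ?sqr_ge0//.
  by have := sqr_ge0 (`|f w| - 1); rewrite sqrrB expr1n real_normK ?num_real//; have := sqr_ge0 (f w); lra.
- under eq_fun do rewrite EFinD; apply: integrableD => //.
    exact: finite_measure_integrable_cst.
  apply/integrableP; split.
    by apply/measurable_EFinP/measurable_funX.
  by under eq_integral do rewrite /= ger0_norm ?sqr_ge0//.
Qed.

(** * Maximal inequality and almost sure convergence of martingale difference series *)

Section martingale_convergence.
Context {R : realType} {d : measure_display} {Omega : measurableType d}.
Variable P : probability Omega R.
Local Open Scope ereal_scope.

Section maximal_inequality.
Variables (G : nat -> set (set Omega)) (u : nat -> Omega -> R) (v : nat -> R).
Hypothesis subG : forall n, <<s G n >> `<=` measurable.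
Hypothesis filG : forall n, <<s G n >> `<=` <<s G n.+1 >>.
Hypothesis adu : forall n, measurable_fun [set: g_sigma_algebraType (G n.+1)] (u n).
Hypothesis u0 : forall n A, <<s G n >> A -> \int[P]_(w in A) (u n w)%:E = 0.
Hypothesis u2 : forall n, \int[P]_w (u n w ^+ 2)%:E <= (v n)%:E.

Variable dl : R.
Hypothesis dl0 : (0 < dl)%R.

Let S n w := stopped_sum dl (u ^~ w) n.

Let adS n : measurable_fun [set: g_sigma_algebraType (G n)] (S n).
Proof.
elim: n => [|n ih]; first exact: measurable_cst.
have adSn : measurable_fun [set: g_sigma_algebraType (G n.+1)] (S n).
  by move=> _ B mB; apply: filG; exact: (ih measurableT B mB).
apply: measurable_fun_ifT => //.
  by apply: measurable_fun_ltr; [exact: measurableT_comp|exact: measurable_cst].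
by apply: measurable_funD => //; exact: adu.
Qed.

Let mS n : measurable_fun setT (S n).
Proof. by apply: (@measurable_fun_subalgebra _ _ _ (G n)); [exact: subG|exact: adS]. Qed.

Let measurable_u n : measurable_fun setT (u n).
Proof. by apply: (@measurable_fun_subalgebra _ _ _ (G n.+1)); [exact: subG|exact: adu]. Qed.

Let iu n : P.-integrable setT (EFin \o u n).
Proof.
by apply: integrable_sqr => //; apply: le_lt_trans (u2 n) _; rewrite ltry.
Qed.

Let intS n : \int[P]_w (S n w ^+ 2)%:E <= \sum_(0 <= k < n) (v k)%:E.
Proof.
elim: n => [|n ih].
  by rewrite big_geq// integral0_eq// => w _; rewrite /S /= expr0n.
(* [Z] is the factor of the cross term: bounded by [dl], known at time [n], and zero where the sum
   is frozen. There the square does not change, and adding [u n w ^+ 2] only enlarges the bound. *)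
pose Z w := if (`|S n w| < dl)%R then S n w else 0%R.
have mZ : measurable_fun [set: g_sigma_algebraType (G n)] Z.
  apply: measurable_fun_ifT; [|exact: adS|exact: measurable_cst].
  apply: measurable_fun_ltr; last exact: measurable_cst.
  by apply: measurableT_comp => //; exact: adS.
have mZ' : measurable_fun setT Z.
  by apply: (@measurable_fun_subalgebra _ _ _ (G n)); [exact: subG|exact: mZ].
have Zdl w : (`|Z w| <= dl)%R.
  by rewrite /Z; case: ifPn => [/ltW//|_]; rewrite normr0 ltW.
have iZu : P.-integrable setT (fun w => (Z w * u n w)%:E).
  apply: (@le_integrable _ _ _ P setT _ _ (fun w => dl%:E * (EFin \o u n) w)) => //.
  - by apply/measurable_EFinP/measurable_funM.
  - move=> w _ /=; rewrite lee_fin !normrM ler_wpM2r//.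
    by rewrite (le_trans (Zdl w))// ler_norm.
  - exact: integrableZl.
have Zu0 := integral_mul_orthogonal P (G n) (subG n) (u n) (iu n) (u0 n) Z mZ iZu.
have i2 (f : Omega -> R) : measurable_fun setT f -> \int[P]_w (f w ^+ 2)%:E < +oo ->
    P.-integrable setT (fun w => (f w ^+ 2)%:E).
  move=> mf f2; apply/integrableP; split.
    by apply/measurable_EFinP/measurable_funX.
  by under eq_integral do rewrite /= ger0_norm ?sqr_ge0//.
have iS2 : P.-integrable setT (fun w => (S n w ^+ 2)%:E).
  by apply: i2 => //; apply: le_lt_trans ih _; rewrite sumEFin ltry.
have iu2 : P.-integrable setT (fun w => (u n w ^+ 2)%:E).
  by apply: i2 => //; apply: le_lt_trans (u2 n) _; rewrite ltry.
rewrite big_nat_recr//=.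
apply: (@le_trans _ _ (\int[P]_w ((S n w ^+ 2)%:E +
   (2%:E * (Z w * u n w)%:E + (u n w ^+ 2)%:E)))).
  apply: ge0_le_integral => //.
  - by move=> w _; rewrite lee_fin sqr_ge0.
  - by apply/measurable_EFinP/measurable_funX.
  - apply: emeasurable_funD; first by apply/measurable_EFinP/measurable_funX.
    apply: emeasurable_funD; last by apply/measurable_EFinP/measurable_funX.
    by apply/measurable_EFinP/measurable_funM => //; apply/measurable_funM.
  - move=> w _; rewrite -EFinM -!EFinD lee_fin /Z /S /= -/(S n w).
    have := sqr_ge0 (u n w).
    by case: ifPn => _; rewrite ?sqrrD; lra.
rewrite integralD//; last by apply: integrableD => //; exact: integrableZl.
apply: leeD => //.
rewrite integralD//; last exact: integrableZl.
by rewrite integralZl// Zu0 mule0 add0e.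
Qed.

Lemma maximal_inequality :
  (dl ^+ 2)%:E * P (\bigcup_n [set w | (dl <= `|series (u ^~ w) n|)%R]) <=
  \sum_(0 <= k <oo) (v k)%:E.
Proof.
have v0 k : 0 <= (v k)%:E.
  by apply: le_trans (u2 k); apply: integral_ge0 => w _; rewrite lee_fin sqr_ge0.
pose F n := [set w | (dl <= `|S n w|)%R].
have mF n : measurable (F n).
  rewrite /F -[X in measurable X]setTI; apply: measurable_fun_le => //.
  exact: measurableT_comp.
(* Chebyshev's inequality for the stopped sum, with a bound uniform in [n] so that it survives the
   monotone limit. *)
have FE n : (dl ^+ 2)%:E * P (F n) <= \sum_(0 <= k <oo) (v k)%:E.
  apply: (@le_trans _ _ (\sum_(0 <= k < n) (v k)%:E)); last exact: nneseries_lim_ge.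
  apply: le_trans (intS n).
  rewrite -integral_cst//.
  apply: (@le_trans _ _ (\int[P]_(w in F n) (S n w ^+ 2)%:E)).
    apply: ge0_le_integral => //.
    - by move=> w _; rewrite lee_fin sqr_ge0.
    - by apply/measurable_EFinP/measurable_funX; exact: measurable_funTS.
    - move=> w Fw; rewrite lee_fin -(real_normK (num_real (S n w))).
      by rewrite ler_sqr ?nnegrE// ltW.
  apply: ge0_subset_integral => //.
    by apply/measurable_EFinP/measurable_funX.
  by move=> w _; rewrite lee_fin sqr_ge0.
have mUF : measurable (\bigcup_n F n) by exact: bigcupT_measurable.
have mseries n : measurable_fun setT (fun w => series (u ^~ w) n).
  by rewrite /series /=; apply: measurable_sum => k.
have mA : measurable (\bigcup_n [set w | (dl <= `|series (u ^~ w) n|)%R]).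
  apply: bigcupT_measurable => n.
  rewrite -[X in measurable X]setTI; apply: measurable_fun_le => //.
  exact: measurableT_comp.
apply: (@le_trans _ _ ((dl ^+ 2)%:E * P (\bigcup_n F n))).
  rewrite lee_wpmul2l ?lee_fin ?sqr_ge0//.
  apply: le_measure; rewrite ?inE//.
  by apply: subset_bigcup => n _ w; exact: le_norm_stopped_sum.
have ndF : nondecreasing_seq F.
  apply/nondecreasing_seqP => n; apply/subsetPset => w.
  exact: le_norm_stopped_sumS.
have cF : (dl ^+ 2)%:E * P (F n) @[n --> \oo] --> (dl ^+ 2)%:E * P (\bigcup_n F n).
  apply: cvgeZl => //.
  exact: nondecreasing_cvg_mu.
rewrite -(cvg_lim _ cF)//; apply: lime_le; first by apply/cvg_ex; eexists; exact: cF.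
exact: nearW.
Qed.

End maximal_inequality.

(** The maximal inequality is applied to the sequence shifted by [m]: the probability that the
    series started at [m] ever reaches [p.+1%:R^-1] is controlled by a tail of the sum of [v], which
    vanishes as [m] grows. Outside countably many null sets, the partial sums are then Cauchy. *)
Theorem cvg_martingale_difference_series
    (G : nat -> set (set Omega)) (u : nat -> Omega -> R) (v : nat -> R) :
  (forall n, <<s G n >> `<=` measurable) ->
  (forall n, <<s G n >> `<=` <<s G n.+1 >>) ->
  (forall n, measurable_fun [set: g_sigma_algebraType (G n.+1)] (u n)) ->
  (forall n A, <<s G n >> A -> \int[P]_(w in A) (u n w)%:E = 0) ->
  (forall n, \int[P]_w (u n w ^+ 2)%:E <= (v n)%:E) ->
  \sum_(0 <= k <oo) (v k)%:E < +oo ->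
  {ae P, forall w, cvgn (series (u ^~ w))}.
Proof.
move=> subG filG adu u0 u2 sumv.
have v0 k : 0 <= (v k)%:E.
  by apply: le_trans (u2 k); apply: integral_ge0 => w _; rewrite lee_fin sqr_ge0.
pose E p m := \bigcup_n [set w |
  ((p.+1%:R^-1 : R) <= `|series (fun k => u (k + m)%N w) n|)%R].
have measurable_u n : measurable_fun setT (u n).
  by apply: (@measurable_fun_subalgebra _ _ _ (G n.+1)); [exact: subG|exact: adu].
have mE p m : measurable (E p m).
  apply: bigcupT_measurable => n.
  rewrite -[X in measurable X]setTI; apply: measurable_fun_le => //.
  apply: measurableT_comp => //.
  by rewrite /series /=; apply: measurable_sum => k.
have PE p m : (p.+1%:R^-1 ^+ 2)%:E * P (E p m) <= \sum_(m <= k <oo) (v k)%:E.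
  rewrite -(@nneseries_addn _ (EFin \o v))//.
  apply: (maximal_inequality (fun n => G (n + m)%N) (fun n => u (n + m)%N)
    (fun n => v (n + m)%N)).
  - by move=> n; exact: subG.
  - by move=> n; exact: filG.
  - by move=> n; exact: adu.
  - by move=> n; exact: u0.
  - by move=> n; exact: u2.
  - by rewrite invr_gt0.
have PE0 p : P (\bigcap_m E p m) = 0.
  apply/eqP; rewrite eq_le measure_ge0 andbT.
  have p2 : (0 < (p.+1%:R^-1 : R) ^+ 2)%R by rewrite exprn_gt0.
  rewrite -(@lee_pmul2l _ (p.+1%:R^-1 ^+ 2)%:E)// mule0.
  have tl := @nneseries_tail_cvg R (EFin \o v) xpredT sumv (fun k _ => v0 k).
  rewrite -(cvg_lim _ tl)//; apply: lime_ge; first by apply/cvg_ex; eexists; exact: tl.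
  apply: nearW => m; apply: le_trans (PE p m).
  rewrite lee_wpmul2l ?lee_fin ?sqr_ge0//.
  apply: le_measure; rewrite ?inE//; last exact: bigcap_inf.
  exact: bigcapT_measurable.
have : P.-negligible (\bigcup_p \bigcap_m E p m).
  apply: negligible_bigcup => p; exists (\bigcap_m E p m); split; [|exact: PE0|by []].
  exact: bigcapT_measurable.
move=> N0; apply: (negligibleS _ N0) => w /=; apply: contra_notP => nE.
apply/cauchy_cvgP; apply: cauchy_exP => e e0.
have [p pe] : exists p, (p.+1%:R^-1 < e)%R.
  exists (Num.trunc e^-1); rewrite -[ltRHS]invrK ltf_pV2 ?posrE ?invr_gt0//.
  exact: truncnS_gt.
have [m Em] : exists m, ~ E p m w.
  apply/existsNP => allE; apply: nE; exists p => // m _; exact: allE.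
(* One centre per radius suffices: the partial sum at [m], from which later ones deviate by less
   than [p.+1%:R^-1]. *)
exists (series (u ^~ w) m); exists m => // n /= mn.
rewrite /ball /= distrC sub_series_geq// -{1}(add0n m) -{1}(subnK mn) big_addn addnK.
apply: le_lt_trans pe; apply: ltW; rewrite ltNge; apply/negP => pu.
by apply: Em; exists (n - m)%N => //=; rewrite seriesEnat.
Qed.

End martingale_convergence.

(** * The noise of the cache iteration *)

Section noise.
Context {R : realType} {N : nat}.
Variables (lam c m : 'I_N -> R).
Hypothesis hN : (1 <= N)%N.
Hypothesis hlam : forall i, 0 < lam i.

Definition drift (x : R) : R :=
  \sum_(i < N) draw_prob lam x i * (lam i * m i - c i).

Lemma sum_rate_gt0 x : 0 < \sum_(j < N) lam j * expR (- (lam j * x)).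
Proof.
rewrite (bigD1 (Ordinal hN))//= ltr_wpDr ?mulr_gt0 ?expR_gt0//.
by apply: sumr_ge0 => j _; rewrite mulr_ge0 ?expR_ge0 ?ltW.
Qed.

Lemma draw_prob_ge0 x i : 0 <= draw_prob lam x i.
Proof.
by rewrite divr_ge0 ?mulr_ge0 ?expR_ge0 ?(ltW (sum_rate_gt0 x)) ?(ltW (hlam i)).
Qed.

Lemma draw_prob_le1 x i : draw_prob lam x i <= 1.
Proof.
rewrite ler_pdivrMr ?sum_rate_gt0// mul1r (bigD1 i)//= lerDl.
by apply: sumr_ge0 => j _; rewrite mulr_ge0 ?expR_ge0 ?ltW.
Qed.

Lemma norm_drift x : `|drift x| <= \sum_(i < N) `|lam i * m i - c i|.
Proof.
apply: le_trans (ler_norm_sum _ _ _) _; apply: ler_sum => i _.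
by rewrite normrM ler_piMl// ger0_norm ?draw_prob_ge0 ?draw_prob_le1.
Qed.

Lemma continuous_draw_prob i : continuous (fun x => draw_prob lam x i).
Proof.
have ce j : continuous (fun x => lam j * expR (- (lam j * x))).
  move=> x; apply: cvgM; first exact: cvg_cst.
  apply: continuous_comp; last exact: continuous_expR.
  by apply: cvgN; apply: cvgM; [exact: cvg_cst|exact: cvg_id].
move=> x; apply: cvgM; first exact: ce.
apply: cvgV; first by rewrite gt_eqF ?sum_rate_gt0.
by apply: cvg_big => //= [|j _]; [exact: add_continuous|exact: ce].
Qed.

Lemma continuous_drift : continuous drift.
Proof.
move=> x; apply: cvg_big => //= [|i _]; first exact: add_continuous.
apply: cvgM; last exact: cvg_cst.
exact: continuous_draw_prob.
Qed.

Context {d : measure_display} {Omega : measurableType d}.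
Variables (P : probability Omega R) (lamhat : 'I_N -> nat -> {RV P >-> R}).
Variables (J : nat -> Omega -> 'I_N) (T : nat -> {RV P >-> R}).
Hypothesis hunbiased : unbiased lam lamhat.
Hypothesis hvar : bounded_variance lamhat.
Hypothesis hdraw : draw_law lam c m lamhat J T.
Hypothesis hindep : estimate_indep c m lamhat J T.

Let X := correction c m lamhat J.
Let Y i n w := lamhat i n w * m i - c i.

(** The generating family of [history], named separately because measurability with respect to the
    past is stated through [g_sigma_algebraType], which takes generators. *)
Let gen n : set (set Omega) := [set A | exists2 B : set R, measurable B &
  (exists2 k, (k <= n)%N & A = T k @^-1` B) \/
  (exists2 k, (k < n)%N & A = X k @^-1` B)].

Definition noise n w : R := X n w - drift (T n w).

Let mJ n i : measurable (J n @^-1` [set i]).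
Proof. by case: (hdraw n i). Qed.

Let mY i n : measurable_fun setT (Y i n).
Proof.
apply: measurable_funB; last exact: measurable_cst.
by apply: measurable_funM => //; exact: measurable_cst.
Qed.

Let XE n w : X n w = \sum_(i < N) \1_(J n @^-1` [set i]) w * Y i n w.
Proof.
rewrite (bigD1 (J n w))//= indicE mem_set// mul1r big1 ?addr0// => i iJ.
by rewrite indicE memNset ?mul0r//= => Ji; rewrite Ji eqxx in iJ.
Qed.

Let mX n : measurable_fun setT (X n).
Proof.
rewrite (_ : X n = fun w => \sum_(i < N) \1_(J n @^-1` [set i]) w * Y i n w).
  apply: measurable_sum => i; apply: measurable_funM; last exact: mY.
  exact: measurable_indic.
by apply/funext => w; rewrite XE.
Qed.

Lemma sub_history n : <<s gen n >> `<=` measurable.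
Proof.
apply: smallest_sub; first exact: sigma_algebra_measurable.
move=> A [B mB [[k _ ->]|[k _ ->]]]; first exact: measurable_funPTI.
by rewrite -[X in measurable X]setTI; exact: mX.
Qed.

Lemma history_mono n : <<s gen n >> `<=` <<s gen n.+1 >>.
Proof.
apply: smallest_sub; first exact: smallest_sigma_algebra.
move=> A [B mB TX]; apply: sub_sigma_algebra; exists B => //.
by case: TX => -[k kn ->]; [left|right]; exists k => //; rewrite (leq_trans kn)// ltnW.
Qed.

(** The index shift matters: [X n] enters the history only at step [n.+1], whereas [noise n] is
    centred over the events of [gen n]. *)
Lemma noise_adapted n : measurable_fun [set: g_sigma_algebraType (gen n.+1)] (noise n).
Proof.
apply: measurable_funB.
  move=> _ B mB; rewrite setTI; apply: sub_sigma_algebra; exists B => //.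
  by right; exists n.
apply: (@measurableT_comp _ _ _ _ _ _ drift); first exact: continuous_measurable_fun continuous_drift.
move=> _ B mB; rewrite setTI; apply: sub_sigma_algebra; exists B => //.
by left; exists n.
Qed.

Let mnoise n : measurable_fun setT (noise n).
Proof. by apply: (@measurable_fun_subalgebra _ _ _ (gen n.+1)); [exact: sub_history|exact: noise_adapted]. Qed.

Lemma noise_sqr_bound : exists C : R, forall n,
  (\int[P]_w (noise n w ^+ 2)%:E <= C%:E)%E.
Proof.
have [M VM] := hvar.
pose K := \sum_(i < N) `|lam i * m i - c i|.
(* The factor 4 comes from using [(a + b)^2 <= 2 a^2 + 2 b^2] twice: on correction minus drift, then
   on [(lamhat - lam) * m + (lam * m - c)]. Summing over all contents dominates the drawn one, so
   the law of the draw is irrelevant here; unbiasedness makes the mean of [(lamhat - lam)^2] the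
   variance. *)
exists (\sum_(i < N) (4 * m i ^+ 2 * M + 4 * (lam i * m i - c i) ^+ 2) + 2 * K ^+ 2) => n.
have mL i : measurable_fun setT (fun w => (lamhat i n w - lam i) ^+ 2).
  by apply: measurable_funX; apply: measurable_funB => //; exact: measurable_cst.
have VE i : (\int[P]_w ((lamhat i n w - lam i) ^+ 2)%:E <= M%:E)%E.
  apply: le_trans (VM i n); rewrite /variance unlock hunbiased/= unlock.
  by under [leRHS]eq_integral => w _ do rewrite /= -expr2.
apply: (@le_trans _ _ (\int[P]_w (\sum_(i < N)
   ((4 * m i ^+ 2)%:E * ((lamhat i n w - lam i) ^+ 2)%:E +
    (4 * (lam i * m i - c i) ^+ 2)%:E) + (2 * K ^+ 2)%:E))%E).
  apply: ge0_le_integral => //.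
  - by move=> w _; rewrite lee_fin sqr_ge0.
  - by apply/measurable_EFinP/measurable_funX.
  - apply: emeasurable_funD => //; apply: emeasurable_sum => i.
    apply: emeasurable_funD => //.
    by apply: emeasurable_funM => //; exact/measurable_EFinP.
  - move=> w _; under eq_bigr do rewrite -EFinM -EFinD.
    rewrite sumEFin -EFinD lee_fin.
    have dK : drift (T n w) ^+ 2 <= K ^+ 2.
      rewrite -(real_normK (num_real (drift _))) ler_sqr ?nnegrE ?norm_drift//.
      by apply: sumr_ge0.
    have XY : X n w ^+ 2 <= \sum_(i < N) (2 * m i ^+ 2 * (lamhat i n w - lam i) ^+ 2 +
        2 * (lam i * m i - c i) ^+ 2).
      rewrite (bigD1 (J n w))//= ler_wpDr//.
        by apply: sumr_ge0 => i _; rewrite -mulrA -exprMn addr_ge0// pmulr_rge0// sqr_ge0.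
      rewrite /X /correction.
      move: (lamhat _ n w) (lam _) (m _) (c _) => a b e f.
      by have := sqr_ge0 ((a - b) * e - (b * e - f)); nra.
    rewrite /noise; apply: (@le_trans _ _ (2 * X n w ^+ 2 + 2 * K ^+ 2)).
      by have := sqr_ge0 (X n w + drift (T n w)); nra.
    rewrite lerD2r; apply: (le_trans (ler_wpM2l _ XY)) => //.
    rewrite mulr_sumr; apply: ler_sum => i _.
    by rewrite mulrDr !mulrA -!natrM.
have i4 i : measurable_fun setT (fun w => (4 * m i ^+ 2)%:E * ((lamhat i n w - lam i) ^+ 2)%:E)%E.
  by apply: emeasurable_funM => //; exact/measurable_EFinP.
have p4 i w : (0 <= (4 * m i ^+ 2)%:E * ((lamhat i n w - lam i) ^+ 2)%:E)%E.
  by rewrite -EFinM lee_fin -mulrA -exprMn pmulr_rge0// sqr_ge0.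
have q4 i : (0 <= (4 * (lam i * m i - c i) ^+ 2)%:E)%E.
  by rewrite lee_fin mulr_ge0 ?sqr_ge0.
rewrite ge0_integralD//; last 3 first.
- by move=> w _; apply: sume_ge0 => i _; rewrite adde_ge0.
- by apply: emeasurable_sum => i; exact: emeasurable_funD.
- by move=> w _; rewrite lee_fin mulr_ge0 ?sqr_ge0.
rewrite integral_cst//= probability_setT mule1 EFinD leeD2r//.
rewrite ge0_integral_sum//; last 2 first.
- by move=> i; exact: emeasurable_funD.
- by move=> i w _; rewrite adde_ge0.
rewrite -sumEFin; apply: lee_sum => i _.
rewrite ge0_integralD// integral_cst//= probability_setT mule1 EFinD leeD2r//.
rewrite ge0_integralZl//; last 3 first.
- exact/measurable_EFinP.
- by move=> w _; rewrite lee_fin sqr_ge0.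
- by rewrite lee_fin mulr_ge0 ?sqr_ge0.
by rewrite [leRHS]EFinM lee_wpmul2l// lee_fin pmulr_rge0// sqr_ge0.
Qed.

(** On [J n = i] the correction is [Y i n]. Independence factors its integral over [A] and this
    event into a probability times [lam i * m i - c i], and the draw law turns that probability into
    the integral of [draw_prob] over [A]. Summed over [i], this is the integral of the drift. *)
Lemma integral_noise n A : <<s gen n >> A ->
  (\int[P]_(w in A) (noise n w)%:E = 0)%E.
Proof.
have [M VM] := hvar => GA.
have mA : measurable A := sub_history n _ GA.
pose L i w := lamhat i n w - lam i.
have iL i : P.-integrable setT (EFin \o L i).
  apply: integrable_sqr.
    by apply: measurable_funB => //; exact: measurable_cst.
  apply: (@le_lt_trans _ _ M%:E); last exact: ltry.
  apply: le_trans (VM i n); rewrite /variance unlock hunbiased/= unlock.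
  by under [leRHS]eq_integral => w _ do rewrite /= -expr2.
have cst_int r : P.-integrable setT (EFin \o cst (r : R)).
  exact: finite_measure_integrable_cst.
have YE i w : (Y i n w)%:E = ((m i)%:E * (EFin \o L i) w +
    (lam i * m i - c i)%:E)%E.
  by rewrite -EFinM -EFinD /Y /L; congr (_%:E); ring.
have iY i : P.-integrable setT (EFin \o Y i n).
  have -> : EFin \o Y i n = fun w => ((m i)%:E * (EFin \o L i) w + (lam i * m i - c i)%:E)%E.
    by apply/funext => w; rewrite -YE.
  by apply: integrableD => //; [exact: integrableZl|exact: cst_int].
have EY i : (\int[P]_w (Y i n w)%:E = (lam i * m i - c i)%:E)%E.
  under eq_integral do rewrite YE.
  rewrite integralD//; [|exact: integrableZl|exact: cst_int].
  rewrite integralZl// integral_cst//= probability_setT mule1.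
  under eq_integral do rewrite /= EFinB.
  rewrite integralB//; last exact: cst_int.
    have := hunbiased i n; rewrite unlock => ->.
    by rewrite integral_cst//= probability_setT mule1 subee// mule0 add0e.
  rewrite (_ : (fun x => _) = (EFin \o L i) \+ (EFin \o cst (lam i)))%E.
    by apply: integrableD => //; exact: cst_int.
  by apply/funext => w /=; rewrite -EFinD /L subrK.
pose q i w := draw_prob lam (T n w) i.
have mq i : measurable_fun setT (q i).
  apply: (@measurableT_comp _ _ _ _ _ _ (fun x => draw_prob lam x i)) => //.
  exact: continuous_measurable_fun (continuous_draw_prob i).
have iq i (r : R) : P.-integrable A (fun w => (q i w * r)%:E).
  apply: (@integrableS _ _ _ P setT) => //.
  apply: (@le_integrable _ _ _ P setT _ _ (EFin \o cst r)) => //.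
    by apply/measurable_EFinP/measurable_funM => //; exact: measurable_cst.
  move=> w _ /=; rewrite lee_fin normrM ler_piMl//.
  by rewrite ger0_norm /q ?draw_prob_ge0 ?draw_prob_le1.
have i1Y i : P.-integrable A (fun w => (\1_(J n @^-1` [set i]) w * Y i n w)%:E).
  apply: (@integrableS _ _ _ P setT) => //.
  apply: (@le_integrable _ _ _ P setT _ _ (EFin \o Y i n)) => //.
    apply/measurable_EFinP/measurable_funM; last exact: mY.
    exact: measurable_indic.
  move=> w _ /=; rewrite lee_fin normrM ler_piMl// indicE.
  by case: (_ \in _) => /=; rewrite ?normr1 ?normr0.
have int1Y i : (\int[P]_(w in A) (\1_(J n @^-1` [set i]) w * Y i n w)%:E =
    \int[P]_(w in A) (q i w * (lam i * m i - c i))%:E)%E.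
  have mD : measurable (A `&` J n @^-1` [set i]) by exact: measurableI.
  transitivity (\int[P]_(w in A `&` J n @^-1` [set i]) (Y i n w)%:E)%E.
    rewrite [RHS]integral_mkcondr; apply: eq_integral => w _.
    by rewrite patchE indicE; case: ifPn => _ /=; rewrite ?mul1r ?mul0r.
  rewrite (integral_indep P _ (Y i n))//; last first.
    move=> B mB.
    (* Independence is assumed for the estimate; events of [Y i n] are pulled back to it along this
       affine map. *)
    have mB' : measurable ((fun x => x * m i - c i) @^-1` B).
      rewrite -[X in measurable X]setTI.
      suff mf : measurable_fun setT (fun x : R => x * m i - c i) by exact: mf.
      apply: measurable_funB; last exact: measurable_cst.
      by apply: measurable_funM => //; exact: measurable_cst.
    exact: (hindep n i A _ GA mB').
  have [_ /(_ A GA) PD] := hdraw n i.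
  rewrite EY PD muleC -integralZl//.
    by apply: eq_integral => w _; rewrite -EFinM mulrC.
  by have := iq i 1; under eq_fun do rewrite mulr1.
have XAE : (\int[P]_(w in A) (X n w)%:E = \int[P]_(w in A) (drift (T n w))%:E)%E.
  under eq_integral do rewrite XE -sumEFin.
  rewrite integral_sum//.
  under [RHS]eq_integral do rewrite /drift -sumEFin.
  by rewrite integral_sum//; [apply: eq_bigr => i _; exact: int1Y|move=> i; exact: iq].
have iD : P.-integrable A (fun w => (drift (T n w))%:E).
  under eq_fun do rewrite /drift -sumEFin.
  by apply: integrable_sum => // i _; exact: iq.
have iX : P.-integrable A (fun w => (X n w)%:E).
  under eq_fun do rewrite XE -sumEFin.
  by apply: integrable_sum => // i _; exact: i1Y.
under eq_integral do rewrite EFinB.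
by rewrite integralB// XAE subee// integrable_fin_num.
Qed.

Lemma cvg_noise_series (eps : nat -> R) :
  (\sum_(0 <= n <oo) (eps n ^+ 2)%:E < +oo)%E ->
  {ae P, forall w, cvgn (series (fun n => eps n * noise n w))}.
Proof.
move=> eps2; have [C noiseC] := noise_sqr_bound.
have C0 : 0 <= C.
  rewrite -lee_fin; apply: le_trans (noiseC 0%N).
  by apply: integral_ge0 => w _; rewrite lee_fin sqr_ge0.
apply: (cvg_martingale_difference_series P gen
  (fun n w => eps n * noise n w) (fun n => C * eps n ^+ 2)).
- exact: sub_history.
- exact: history_mono.
- by move=> n; apply: measurable_funM; [exact: measurable_cst|exact: noise_adapted].
- move=> n A GA; have mA := sub_history n _ GA.
  under eq_integral do rewrite EFinM.
  rewrite integralZl ?integral_noise ?mule0//.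
  apply: (@integrableS _ _ _ P setT) => //; apply: integrable_sqr => //.
  exact: le_lt_trans (noiseC n) (ltry _).
- move=> n; under eq_integral do rewrite exprMn EFinM.
  rewrite ge0_integralZl_EFin ?sqr_ge0//.
  + by rewrite [X in (_ <= X%:E)%E]mulrC [leRHS]EFinM lee_wpmul2l// lee_fin sqr_ge0.
  + by move=> w _; rewrite lee_fin sqr_ge0.
  + by apply/measurable_EFinP/measurable_funX.
- under eq_eseriesr do rewrite EFinM.
  rewrite nneseriesZl => [|n _]; last by rewrite lee_fin sqr_ge0.
  by rewrite lte_mul_pinfty ?lee_fin.
Qed.

End noise.

(** * Projected iterations on an interval *)

Section projected_iteration.
Context {R : realType}.
Implicit Types (x e u : nat -> R) (g : R -> R).

(** Between [p] and [q] the drift does not push upwards, so a path that has left the region below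
    [p] can rise only through the noise, and late increments of a convergent series are small. *)
Lemma no_late_upcrossing x e u g (p q : R) :
  0 <= p < q ->
  (forall n, 0 <= e n) ->
  (forall n, 0 < x n.+1 -> x n.+1 <= x n + e n * g (x n) + u n) ->
  e n * g (x n) @[n --> \oo] --> 0 -> cvgn (series u) ->
  (forall y, p <= y <= q -> g y <= 0) ->
  exists m, forall n, (m <= n)%N -> x n <= p ->
    forall k, (n <= k)%N -> x k < q.
Proof.
move=> /andP[p0 pq] e0 xS eg0 /cauchy_cvgP/cauchyP cu gle0.
(* One quarter pays for the drift of the step that leaves the region below [p], two for the
   oscillation of [series u], and the last keeps the inequality strict. *)
pose dl := (q - p) / 4.
have dl0 : 0 < dl by rewrite divr_gt0// subr_gt0.
have [s [m1 _ Hm1]] := cu dl dl0.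
have /cvgrPdist_lt /(_ dl dl0)[m2 _ Hm2] := eg0.
exists (maxn m1 m2) => n; rewrite geq_max => /andP[m1n m2n] xnp.
have us i j : (m1 <= i)%N -> (m1 <= j)%N -> series u i - series u j < 2 * dl.
  move=> /Hm1 + /Hm1; rewrite /ball /= !ltr_norml => /andP[? ?] /andP[? ?]; lra.
(* The witness [j] is the time from which noise is counted: it is reset whenever the path is at most
   [p] or lands at or below 0, and kept otherwise. *)
suff H k : exists2 j, (m1 <= j)%N & x (n + k)%N <= p + dl + (series u (n + k)%N - series u j).
  move=> k nk; have [j m1j] := H (k - n)%N; rewrite subnKC// => /le_lt_trans; apply.
  have := us k j (leq_trans m1n nk) m1j; have -> : q = p + 4 * dl by rewrite /dl; field.
  lra.
elim: k => [|k [j m1j ih]]; first by exists n => //; rewrite addn0 subrr addr0; lra.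
rewrite addnS; have m1nk : (m1 <= n + k)%N by rewrite (leq_trans m1n)// leq_addr.
have [x0|x0] := leP (x (n + k).+1) 0.
  by exists (n + k).+1; rewrite ?(leq_trans m1nk)// subrr addr0; lra.
have := xS _ x0; have [xp|xp] := leP (x (n + k)%N) p.
  exists (n + k)%N => //; rewrite seriesSr.
  have /= := Hm2 (n + k)%N (leq_trans m2n (leq_addr _ _)).
  by rewrite sub0r normrN ltr_norml => /andP[? ?]; lra.
exists j => //; rewrite seriesSr.
have usj := us (n + k)%N j m1nk m1j; have q4 : q = p + 4 * dl by rewrite /dl; field.
have gx : g (x (n + k)%N) <= 0 by apply: gle0; lra.
by have := mulr_ge0_le0 (e0 (n + k)%N) gx; lra.
Qed.

(** The reflection [b - x] exchanges the two directions and turns the barrier [b] into 0. *)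
Lemma no_late_downcrossing x e u g (b p q : R) :
  p < q <= b ->
  (forall n, 0 <= e n) ->
  (forall n, x n.+1 < b -> x n + e n * g (x n) + u n <= x n.+1) ->
  e n * g (x n) @[n --> \oo] --> 0 -> cvgn (series u) ->
  (forall y, p <= y <= q -> 0 <= g y) ->
  exists m, forall n, (m <= n)%N -> q <= x n ->
    forall k, (n <= k)%N -> p < x k.
Proof.
move=> /andP[pq qb] e0 xS eg0 cu gge0.
have [|||||m Hm] := no_late_upcrossing (fun n => b - x n) e (fun n => - u n)
  (fun y => - g (b - y)) (b - q) (b - p) _ e0.
- by rewrite subr_ge0 qb ltrD2l ltrN2.
- by move=> n; rewrite subr_gt0 => /xS; rewrite subKr mulrN; lra.
- rewrite -oppr0; under eq_fun do rewrite subKr mulrN.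
  exact: cvgN.
- by rewrite (_ : (fun n => - u n) = - u)// is_cvg_seriesN.
- by move=> y /andP[? ?]; rewrite oppr_le0; apply: gge0; lra.
exists m => n mn qx k nk.
have xq : b - x n <= b - q by lra.
by have := Hm n mn xq k nk; lra.
Qed.

(** [sup A] is the limit inferior and [inf B] the limit superior. If they differed, the path would
    visit both sides of the middle third of the gap infinitely often; forbidding late crossings in
    either direction would yield an eventual bound strictly inside the gap. *)
Lemma cvg_of_no_crossing x (a b : R) : (forall n, a <= x n <= b) ->
  (forall p q, a < p -> p < q -> q < b ->
     (exists m, forall n, (m <= n)%N -> x n <= p -> forall k, (n <= k)%N -> x k < q) \/
     (exists m, forall n, (m <= n)%N -> q <= x n -> forall k, (n <= k)%N -> p < x k)) ->
  cvgn x.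
Proof.
move=> xab cross.
pose A := [set y | exists m, forall n, (m <= n)%N -> y <= x n].
pose B := [set y | exists m, forall n, (m <= n)%N -> x n <= y].
have Aa : A a by exists 0%N => n _; case/andP: (xab n).
have Bb : B b by exists 0%N => n _; case/andP: (xab n).
have AB y z : A y -> B z -> y <= z.
  move=> [i Ai] [j Bj]; apply: (@le_trans _ _ (x (maxn i j))).
    by apply: Ai; exact: leq_maxl.
  by apply: Bj; exact: leq_maxr.
have hA : has_sup A by split; [exists a|exists b => y Ay; exact: AB].
have hB : has_inf B by split; [exists b|exists a => y By; exact: AB].
have leA y : A y -> y <= sup A by move=> Ay; apply: ub_le_sup => //; case: hA.
have leB y : B y -> inf B <= y by move=> By; apply: ge_inf => //; case: hB.
have supinf : inf B <= sup A.
  rewrite leNgt; apply/negP => lt; pose h := (inf B - sup A) / 3.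
  have h0 : 0 < h by rewrite divr_gt0 // subr_gt0.
  have hE : inf B = sup A + 3 * h by rewrite /h; field.
  have aA := leA a Aa; have bB := leB b Bb.
  have [[m Hm]|[m Hm]] := cross (sup A + h) (sup A + 2 * h) ltac:(lra) ltac:(lra) ltac:(lra).
  - have [n mn xn] : exists2 n, (m <= n)%N & x n <= sup A + h.
      apply: contrapT => nex; have : sup A + h <= sup A; last lra.
      apply: leA; exists m => n mn; rewrite leNgt; apply/negP => xlt; apply: nex.
      by exists n => //; exact: ltW.
    have : inf B <= sup A + 2 * h; last lra.
    by apply: leB; exists n => k nk; apply/ltW/(Hm n).
  - have [n mn xn] : exists2 n, (m <= n)%N & sup A + 2 * h <= x n.
      apply: contrapT => nex; have : inf B <= sup A + 2 * h; last lra.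
      apply: leB; exists m => n mn; rewrite leNgt; apply/negP => xlt; apply: nex.
      by exists n => //; exact: ltW.
    have : sup A + h <= sup A; last lra.
    by apply: leA; exists n => k nk; apply/ltW/(Hm n).
apply/cvg_ex; exists (sup A); apply/cvgrPdist_lt => e e0.
have [y [i Ai] ylt] := sup_adherent e0 hA.
have [z [j Bj] zlt] := inf_adherent e0 hB.
exists (maxn i j) => // n /=; rewrite geq_max => /andP[/Ai yx /Bj xz].
by rewrite ltr_norml; apply/andP; split; lra.
Qed.

(* Whatever the sign pattern of [g], every interval contains a subinterval on
   which [g] has constant sign, and no such subinterval is crossed in both
   directions infinitely often; hence [g] need not have isolated zeros. *)
Lemma cvg_projected_iteration x e u g (b : R) :
  (forall n, 0 <= x n <= b) -> (forall n, 0 <= e n) ->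
  (forall n, 0 < x n.+1 -> x n.+1 <= x n + e n * g (x n) + u n) ->
  (forall n, x n.+1 < b -> x n + e n * g (x n) + u n <= x n.+1) ->
  e n * g (x n) @[n --> \oo] --> 0 -> cvgn (series u) -> continuous g ->
  cvgn x.
Proof.
move=> x0b e0 xSl xSr eg0 cu cg; apply: (cvg_of_no_crossing x 0 b x0b) => p q p0 pq qb.
have up p' q' : p <= p' -> p' < q' -> q' <= q -> (forall y, p' <= y <= q' -> g y <= 0) ->
    exists m, forall n, (m <= n)%N -> x n <= p -> forall k, (n <= k)%N -> x k < q.
  move=> pp' pq' qq' gs.
  have [|m Hm] := no_late_upcrossing x e u g p' q' _ e0 xSl eg0 cu gs; first by lra.
  by exists m => n mn xp k nk; apply: lt_le_trans qq'; apply: Hm nk => //; lra.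
have dn p' q' : p <= p' -> p' < q' -> q' <= q -> (forall y, p' <= y <= q' -> 0 <= g y) ->
    exists m, forall n, (m <= n)%N -> q <= x n -> forall k, (n <= k)%N -> p < x k.
  move=> pp' pq' qq' gs.
  have [|m Hm] := no_late_downcrossing x e u g b p' q' _ e0 xSr eg0 cu gs; first by lra.
  by exists m => n mn xp k nk; apply: le_lt_trans pp' _; apply: Hm nk => //; lra.
have [[y [/andP[py yq] gy]]|all0] := pselect (exists y, p < y < q /\ 0 < g y).
  right.
  have [r r0 Hr] : exists2 r, 0 < r & forall z, y <= z <= y + r -> 0 <= g z.
    have /cvgrPdist_lt /(_ _ gy) := cg y; rewrite nearE => -[r /= r0 Hr].
    exists (r / 2); first by rewrite divr_gt0.
    move=> z yz; have : `|g y - g z| < g y.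
      by apply: Hr; rewrite /= ltr_norml; lra.
    by rewrite ltr_norml; lra.
  apply: (dn y (Num.min q (y + r))) => //; first exact: ltW.
  - by rewrite lt_min yq ltrDl.
  - by rewrite ge_min lexx.
  - by move=> z /andP[yz]; rewrite le_min => /andP[zq zr]; apply: Hr; rewrite yz.
(* The closed middle third lies inside the open interval, the only place where [all0] gives a
   sign. *)
left; apply: (up (p + (q - p) / 3) (p + 2 * ((q - p) / 3))); [lra..|].
by move=> y hy; rewrite leNgt; apply/negP => gy; apply: all0; exists y; split => //; lra.
Qed.

(** If [g l] were positive, the path, eventually away from the barrier [b], would gain at least
    [e n * (g l / 2)] at each step apart from the noise. Both the path and the noise series are
    bounded, hence so would be [series e]. *)
Lemma limit_projected_iteration_le0 x e u g (b l : R) :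
  (forall n, 0 <= e n) ->
  (forall n, x n.+1 < b -> x n + e n * g (x n) + u n <= x n.+1) ->
  (\sum_(0 <= n <oo) (e n)%:E = +oo)%E ->
  cvgn (series u) -> continuous g ->
  x n @[n --> \oo] --> l -> l < b -> g l <= 0.
Proof.
move=> e0 xS eoo cu cg xl lb; rewrite leNgt; apply/negP => gl.
have gx : g (x n) @[n --> \oo] --> g l by apply: continuous_cvg => //; exact: cg.
have gl2 : g l / 2 < g l by lra.
have xb : \forall n \near \oo, x n < b by exact: cvgr_lt xl _ lb.
have gg : \forall n \near \oo, g l / 2 < g (x n) by exact: cvgr_gt gx _ gl2.
have /cvg_ex[L uL] := cu.
have v1 : \forall n \near \oo, x n - series u n < l - L + 1.
  have vl : x n - series u n @[n --> \oo] --> l - L by exact: cvgB.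
  by apply: cvgr_lt vl _ _; rewrite ltrDl.
have [m _ Hm] : \forall n \near \oo, [/\ x n < b, g l / 2 < g (x n) &
    x n - series u n < l - L + 1] by near=> n; split; near: n.
(* Nondecreasing from [m] on; with the bound on [x n - series u n] this yields the constant [K]
   below. *)
pose y n := x n - g l / 2 * series e n - series u n.
have yS k : y m <= y (m + k)%N.
  elim: k => [|k ih]; first by rewrite addn0.
  apply: le_trans ih _; rewrite /y addnS !seriesSr.
  have [_ gk _] := Hm (m + k)%N (leq_addr _ _).
  have [xk _ _] := Hm (m + k).+1 (leqW (leq_addr _ _)).
  have := ler_wpM2l (e0 (m + k)%N) (ltW gk); have := xS _ xk; lra.
pose K := (l - L + 1 - y m) / (g l / 2).
have eK n : (m <= n)%N -> series e n <= K.
  move=> mn; rewrite ler_pdivlMr ?divr_gt0//.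
  have [_ _ vn] := Hm n mn; have := yS (n - m)%N; rewrite subnKC// /y; lra.
have : (\sum_(0 <= n <oo) (e n)%:E <= K%:E)%E.
  apply: lime_le; first by apply: is_cvg_nneseries => n _ _; rewrite lee_fin.
  by exists m => // n /= mn; rewrite sumEFin lee_fin; exact: eK.
by rewrite eoo.
Unshelve. all: by end_near. Qed.

Lemma limit_projected_iteration_ge0 x e u g (l : R) :
  (forall n, 0 <= e n) ->
  (forall n, 0 < x n.+1 -> x n.+1 <= x n + e n * g (x n) + u n) ->
  (\sum_(0 <= n <oo) (e n)%:E = +oo)%E ->
  cvgn (series u) -> continuous g ->
  x n @[n --> \oo] --> l -> 0 < l -> 0 <= g l.
Proof.
move=> e0 xS eoo cu cg xl l0; rewrite -oppr_le0.
have cN : continuous (fun y : R => - g (- y)).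
  move=> y; apply: cvgN; apply: continuous_comp; last exact: cg.
  exact: opp_continuous.
have := limit_projected_iteration_le0 (fun n => - x n) e (fun n => - u n)
  (fun y => - g (- y)) 0 (- l) e0 _ eoo _ cN; rewrite opprK; apply.
- by move=> n; rewrite oppr_lt0 => /xS; rewrite opprK mulrN; lra.
- by rewrite (_ : (fun n => - u n) = - u)// is_cvg_seriesN.
- exact: cvgN.
- by rewrite oppr_lt0.
Qed.

End projected_iteration.

(** * Extrema of the cost *)

Section cost_extrema.
Context {R : realType} {N : nat}.
Variables (lam c m : 'I_N -> R).
Hypothesis hN : (1 <= N)%N.
Hypothesis hlam : forall i, 0 < lam i.

Let S x := \sum_(j < N) lam j * expR (- (lam j * x)).

(** The factor [S x] undoes the normalisation in [draw_prob]. As it is positive, the stationary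
    points of the cost are exactly the zeros of the drift. *)
Lemma is_derive_ttl_cost (x : R) :
  is_derive x 1 (ttl_cost lam c m) (- (S x * drift lam c m x)).
Proof.
have S0 : S x != 0 by rewrite gt_eqF ?sum_rate_gt0.
have -> : - (S x * drift lam c m x) =
    \sum_(i < N) (lam i * m i - c i) * (expR (- (lam i * x)) * - lam i).
  rewrite /drift mulr_sumr -sumrN; apply: eq_bigr => i _.
  by rewrite /draw_prob -/(S x); field.
have -> : ttl_cost lam c m =
    \sum_(i < N) (fun y => c i + (lam i * m i - c i) * expR (- (lam i * y))).
  by apply/funext => y; rewrite fct_sumE.
apply: is_derive_sum => i.
have dl : is_derive x 1 ((- lam i) \*: (id : R -> R)) (- lam i).
  by apply: is_derive_eq; rewrite /GRing.scale /= mulr1.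
have de : is_derive x 1 (expR \o ((- lam i) \*: (id : R -> R)))
    (expR (- (lam i * x)) * - lam i).
  by rewrite -[- (lam i * x)]mulNr; exact: is_derive1_comp.
have -> : (fun y => c i + (lam i * m i - c i) * expR (- (lam i * y))) =
    cst (c i) + (lam i * m i - c i) \*: (expR \o ((- lam i) \*: (id : R -> R))).
  by apply/funext => y; rewrite -mulNr.
by apply: is_derive_eq; rewrite add0r.
Qed.

Lemma ttl_cost_continuous : continuous (ttl_cost lam c m).
Proof.
move=> x; apply: differentiable_continuous; apply/derivable1_diffP.
by have [] := is_derive_ttl_cost x.
Qed.

Lemma ttl_cost_increment (a b : R) : a <= b -> exists2 y, a <= y <= b &
  ttl_cost lam c m b - ttl_cost lam c m a = - (S y * drift lam c m y) * (b - a).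
Proof.
move=> ab; have [|y] := MVT_segment ab (fun x _ => is_derive_ttl_cost x).
  exact: continuous_subspaceT ttl_cost_continuous.
by rewrite in_itv; exists y.
Qed.

(** Continuity spreads the strict sign of the drift to a neighbourhood, where the mean value theorem
    makes the cost nondecreasing away from 0. Zero drift is left to the stationary alternative. *)
Lemma local_min_left (b : R) : 0 < b -> drift lam c m 0 < 0 ->
  local_min_on `[0, b] (ttl_cost lam c m) 0.
Proof.
move=> b0 d0; split; first by rewrite /= in_itv/= lexx ltW.
have : \forall y \near 0, drift lam c m y < 0.
  exact: cvgr_lt (continuous_drift lam c m hN hlam 0) _ d0.
rewrite nearE => -[r /= r0 Hr]; exists r => //= y yr; rewrite /= in_itv/= => /andP[y0 yb].
have [z /andP[z0 zy] cE] := ttl_cost_increment _ _ y0.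
have zr : drift lam c m z < 0.
  apply: Hr => /=; apply: le_lt_trans yr.
  by rewrite !sub0r !normrN !ger0_norm.
rewrite -subr_ge0 cE mulr_ge0 ?subr_ge0// oppr_ge0 pmulr_rle0 ?ltW//.
exact: sum_rate_gt0.
Qed.

Lemma local_min_right (b : R) : 0 < b -> 0 < drift lam c m b ->
  local_min_on `[0, b] (ttl_cost lam c m) b.
Proof.
move=> b0 d0; split; first by rewrite /= in_itv/= lexx ltW.
have : \forall y \near b, 0 < drift lam c m y.
  exact: cvgr_gt (continuous_drift lam c m hN hlam b) _ d0.
rewrite nearE => -[r /= r0 Hr]; exists r => //= y yr; rewrite /= in_itv/= => /andP[y0 yb].
have [z /andP[z0 zy] cE] := ttl_cost_increment _ _ yb.
have zr : 0 < drift lam c m z.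
  apply: Hr => /=; apply: le_lt_trans yr.
  by rewrite !ger0_norm ?subr_ge0// lerD2l lerN2.
rewrite -subr_le0 cE mulr_le0_ge0 ?subr_ge0// oppr_le0 pmulr_rge0 ?ltW//.
exact: sum_rate_gt0.
Qed.

End cost_extrema.

(** * Almost sure limits of the timer *)

Theorem proposition1 (R : realType) (N : nat) (lam c m : 'I_N -> R) (Tmax : R)
  (d : measure_display) (Omega : measurableType d) (P : probability Omega R)
  (lamhat : 'I_N -> nat -> {RV P >-> R}) (J : nat -> Omega -> 'I_N)
  (T : nat -> {RV P >-> R}) (eps : nat -> R)
  (hN : (1 <= N)%N)
  (hlam : forall i, 0 < lam i) (hc : forall i, 0 < c i)
  (hm : forall i, 0 <= m i) (hTmax : 0 < Tmax)
  (hunbiased : unbiased lam lamhat)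
  (hvar : bounded_variance lamhat)
  (hdraw : draw_law lam c m lamhat J T)
  (hindep : estimate_indep c m lamhat J T)
  (heps_ge0 : forall n, 0 <= eps n)
  (heps_cvg0 : eps n @[n --> \oo] --> (0 : R))
  (heps_sum : (\sum_(0 <= n <oo) (eps n)%:E = +oo)%E)
  (heps_sq : (\sum_(0 <= n <oo) (eps n ^+ 2)%:E < +oo)%E)
  (hT0 : forall w, 0 <= T 0%N w <= Tmax)
  (hTS : forall n w,
     T n.+1 w = proj_itv Tmax (T n w + eps n * correction c m lamhat J n w)) :
  {ae P, forall w, exists l : R,
     T n w @[n --> \oo] --> l /\
     [\/ stationary_point (ttl_cost lam c m) l,
         l = 0 /\ local_min_on `[0, Tmax] (ttl_cost lam c m) 0 |
         l = Tmax /\ local_min_on `[0, Tmax] (ttl_cost lam c m) Tmax]}.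
Proof.
apply: filterS (cvg_noise_series lam c m hN hlam P lamhat J T hunbiased hvar hdraw hindep eps heps_sq) => w cu.
pose g := drift lam c m.
have TE n : T n.+1 w = proj_itv Tmax (T n w + eps n * g (T n w) +
    eps n * noise lam c m P lamhat J T n w).
  by rewrite hTS /noise -addrA -mulrDr addrCA subrr addr0.
have x0b n : 0 <= T n w <= Tmax.
  case: n => [|n]; first exact: hT0.
  by rewrite TE /proj_itv le_min le_max lexx (ltW hTmax) ge_min lexx orbT.
(* A positive value has not been clipped at 0, and clipping at [Tmax] only lowers it. The lower
   bound [xSr] is symmetric. *)
have xSl n : 0 < T n.+1 w -> T n.+1 w <= T n w + eps n * g (T n w) +
    eps n * noise lam c m P lamhat J T n w.
  rewrite TE /proj_itv lt_min lt_max ltxx /= => /andP[z0 _].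
  by rewrite ge_min ge_max (ltW z0) lexx.
have xSr n : T n.+1 w < Tmax -> T n w + eps n * g (T n w) +
    eps n * noise lam c m P lamhat J T n w <= T n.+1 w.
  rewrite TE /proj_itv gt_min ltxx orbF => /ltW z0.
  by rewrite le_min le_max lexx orbT; apply: le_trans z0; rewrite le_max lexx orbT.
have cg : continuous g by exact: continuous_drift.
have eg0 : eps n * g (T n w) @[n --> \oo] --> 0.
  pose K := \sum_(i < N) `|lam i * m i - c i|.
  apply/norm_cvg0P.
  apply: (@squeeze_cvgr _ _ _ _ (cst 0) (fun n => eps n * K)); last 2 first.
  - exact: cvg_cst.
  - by rewrite -(mul0r K); apply: cvgM => //; exact: cvg_cst.
  apply: nearW => n; rewrite normr_ge0 normrM (ger0_norm (heps_ge0 n)) ler_wpM2l//.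
  exact: norm_drift.
have /cvg_ex[l xl] := cvg_projected_iteration _ _ _ _ _ x0b heps_ge0 xSl xSr eg0 cu cg.
have l0 : 0 <= l.
  by apply: (cvgr_to_ge xl); apply: nearW => n; case/andP: (x0b n).
have lT : l <= Tmax.
  by apply: (cvgr_to_le xl); apply: nearW => n; case/andP: (x0b n).
exists l; split => //.
(* A nonzero drift at the limit forces the endpoint towards which it points, with the strict sign
   needed for a local minimum; zero drift is stationarity, also at an endpoint. *)
have [gl|gl|gl] := ltgtP (g l) 0.
- constructor 2; have l00 : l = 0.
    apply/eqP; rewrite eq_le l0 andbT leNgt; apply/negP => lgt.
    have := limit_projected_iteration_ge0 _ _ _ _ _ heps_ge0 xSl heps_sum cu cg xl lgt.
    by rewrite leNgt gl.
  by split => //; apply: local_min_left => //; move: gl; rewrite l00.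
- constructor 3; have lTT : l = Tmax.
    apply/eqP; rewrite eq_le lT leNgt; apply/negP => lgt.
    have := limit_projected_iteration_le0 _ _ _ _ _ _ heps_ge0 xSr heps_sum cu cg xl lgt.
    by rewrite leNgt gl.
  by split => //; apply: local_min_right => //; move: gl; rewrite lTT.
- constructor 1; rewrite /stationary_point.
  by have := is_derive_ttl_cost lam c m hN hlam l; rewrite -/g gl mulr0 oppr0.
Qed.
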